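(* Let $R$ be a unital ring with involution and let $a\in R$ be core invertible with core inverse $a^{\mathrm{core}}$. Then the following are equivalent: (1) $a$ is an EP element; (2) there exists a unit $u\in R$ such that $a^{\mathrm{core}}=ua$; (3) there exists an element $b\in R$ such that $a^{\mathrm{core}}=ba$.
   Context: A unital (associative, not necessarily commutative) ring with involution is a unital ring $R$ with a map $a\mapsto a^*$ satisfying $(a^* )^*=a$, $(ab)^*=b^*a^*$, $(a+b)^*=a^*+b^*$ for all $a,b\in R$. Notation: $aR=\{ar:r\in R\}$, $Ra=\{ra:r\in R\}$. The Moore-Penrose inverse of $a\in R$ is the element $a^\dagger=x$ (unique if it exists) with $axa=a$, $xax=x$, $(ax)^*=ax$, $(xa)^*=xa$; the group inverse of $a$ is the element $a^\#=x$ (unique if it exists) with $axa=a$, $xax=x$, $ax=xa$. An element $a\in R$ is EP if it is both Moore-Penrose invertible and group invertible and $a^\dagger=a^\#$. The core inverse of $a$ is the element $a^{\mathrm{core}}=x$ (unique if it exists) with $axa=a$, $xR=aR$ and $Rx=Ra^*$; $a$ is core invertible if it exists. *)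

(* Defs.v *)
From mathcomp Require Import all_boot all_algebra.
Set Implicit Arguments.
Unset Strict Implicit.
Unset Printing Implicit Defensive.
Import GRing.Theory.
Local Open Scope ring_scope.

(* [pzRingType] rather than [nzRingType]: "unital ring" does not exclude the
   zero ring.  Units are therefore defined below, since [GRing.unit] is only
   available on a [unitRingType], which is nontrivial and assumes a decision
   procedure for invertibility. *)

Definition ring_involution (R : pzRingType) (star : R -> R) : Prop :=
  [/\ involutive star,
      forall a b, star (a * b) = star b * star a
    & forall a b, star (a + b) = star a + star b].

Definition two_sided_unit (R : pzRingType) (u : R) : Prop :=
  exists v : R, u * v = 1 /\ v * u = 1.

Definition right_principal (R : pzRingType) (a : R) : R -> Prop :=
  fun z => exists r : R, z = a * r.

Definition left_principal (R : pzRingType) (a : R) : R -> Prop :=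
  fun z => exists r : R, z = r * a.

Definition is_moore_penrose (R : pzRingType) (star : R -> R) (a x : R) : Prop :=
  [/\ a * x * a = a, x * a * x = x, star (a * x) = a * x
    & star (x * a) = x * a].

Definition is_group_inverse (R : pzRingType) (a x : R) : Prop :=
  [/\ a * x * a = a, x * a * x = x & a * x = x * a].

Definition is_EP (R : pzRingType) (star : R -> R) (a : R) : Prop :=
  exists x y : R,
    [/\ is_moore_penrose star a x, is_group_inverse a y & x = y].

(* The equalities xR = aR and Rx = Ra^* of subsets are stated extensionally. *)
Definition is_core_inverse (R : pzRingType) (star : R -> R) (a x : R) : Prop :=
  [/\ a * x * a = a,
      forall z, right_principal x z <-> right_principal a z
    & forall z, left_principal x z <-> left_principal (star a) z].

(* Main.v *)
Require Import Defs.
From mathcomp Require Import all_boot all_algebra.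
Import GRing.Theory.
Local Open Scope ring_scope.

(** Write [x] for the core inverse of [a].  The ideal conditions [xR = aR] and
    [Rx = Ra^*] yield the equations [x a x = x], [(a x)^* = a x],
    [x a^2 = a] and [a x^2 = x] ([core_inverse_equations]).  So [x] is
    already an inner and outer inverse with one of the two Moore-Penrose
    symmetries, and the only thing separating [a] from being EP is the
    commutation [a x = x a].

    If [a] is EP, its Moore-Penrose inverse [y] is also its group inverse and
    must equal [x] ([core_inverse_of_EP]).  With [e = a y = y a], the element
    [a] is invertible in the corner ring [eRe] with inverse [y], and
    [u = y^2 + (1 - e)] is a unit of [R] such that [u a = y]
    ([group_inverse_unit_multiple]).  Conversely, if [x = b a] then
    [x = b (a x a) = x^2 a], because [b a = x] again, and multiplying by [a] on
    the left gives [a x = (a x^2) a = x a]. *)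

(** Membership [x \in R a^*] turns [a x a = a] into [x = x (a x)^*]; hence
    [a x = (a x) (a x)^*] is self-adjoint, which in turn gives [x a x = x].
    The last two equations come from [a \in x R] and [x \in a R], since
    [x a] fixes [x] and [a x] fixes [a]. *)
Lemma core_inverse_equations (R : pzRingType) (star : R -> R) (a x : R) :
  ring_involution star -> is_core_inverse star a x ->
  [/\ x * a * x = x, star (a * x) = a * x, x * a * a = a & a * x * x = x].
Proof.
move=> [starK starM _] [axa imE coimE].
have [r xE] : right_principal a x by apply/imE; exists 1; rewrite mulr1.
have [s aE] : right_principal x a by apply/imE; exists 1; rewrite mulr1.
have [t xE'] : left_principal (star a) x.
  by apply/coimE; exists 1; rewrite mul1r.
have x_star : x = x * star (a * x).
  by rewrite {2}xE' -mulrA -starM axa.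
have sym : star (a * x) = a * x.
  have E : a * x = a * x * star (a * x) by rewrite -mulrA -x_star.
  by rewrite E starM starK.
have xax : x * a * x = x by rewrite -mulrA -sym -x_star.
split=> //.
- by rewrite {2}aE mulrA xax -aE.
- by rewrite {2}xE mulrA axa -xE.
Qed.

(** The idempotents [a x] and [a y] are self-adjoint with the same right ideal
    [aR], hence equal; likewise [x a = y a], because [x a] fixes [a] while
    [y] commutes with [a].  An outer inverse [x] is determined by [a x] and
    [x a]. *)
Lemma core_inverse_of_EP (R : pzRingType) (star : R -> R) (a x y : R) :
  ring_involution star -> is_core_inverse star a x ->
  is_moore_penrose star a y -> is_group_inverse a y -> x = y.
Proof.
move=> inv core [aya yay symy _] [_ _ comm].
have [xax symx xaa _] := core_inverse_equations R star a x inv core.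
have [_ starM _] := inv; have [axa _ _] := core.
have axE : a * x = a * y.
  have absorb : a * x = a * y * (a * x) by rewrite mulrA aya.
  by rewrite -symx absorb starM symx symy mulrA axa.
have xaE : x * a = y * a by rewrite -{1}aya -[a * y * a]mulrA -comm !mulrA xaa.
by rewrite -xax xaE -mulrA axE mulrA yay.
Qed.

(** With [e = a y], both [y^2] and [a^2] lie in [eRe] and are inverse to each
    other there; adding [1 - e] completes them to mutually inverse elements of
    [R].  As [1 - e] kills [a], the unit sends [a] to [y^2 a = y]. *)
Lemma group_inverse_unit_multiple (R : pzRingType) (a y : R) :
  is_group_inverse a y -> exists u : R, two_sided_unit u /\ y = u * a.
Proof.
move=> [aya yay comm].
have ea : (1 - a * y) * a = 0 by rewrite mulrBl mul1r aya subrr.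
have ae : a * (1 - a * y) = 0 by rewrite mulrBr mulr1 comm mulrA aya subrr.
have ey : (1 - a * y) * y = 0 by rewrite mulrBl mul1r comm yay subrr.
have ye : y * (1 - a * y) = 0 by rewrite mulrBr mulr1 mulrA yay subrr.
have ee : (1 - a * y) * (1 - a * y) = 1 - a * y.
  by rewrite mulrBr mulr1 mulrA ea mul0r subr0.
have yyaa : y * y * (a * a) = a * y.
  by rewrite mulrA -[y * y * a]mulrA -comm mulrA yay comm.
have aayy : a * a * (y * y) = a * y.
  by rewrite mulrA -[a * a * y]mulrA comm mulrA aya comm.
have ef : a * y + (1 - a * y) = 1 by rewrite addrC subrK.
(* Abstracting the complementary idempotent keeps distributivity from
   expanding it. *)
move: (1 - a * y) ea ae ey ye ee ef => f fa af fy yf ff ef.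
exists (y * y + f); split; last first.
  by rewrite mulrDl fa addr0 -mulrA -comm mulrA yay.
exists (a * a + f); split.
- rewrite mulrDr !mulrDl yyaa ff [f * (a * a)]mulrA fa mul0r addr0.
  by rewrite -[y * y * f]mulrA yf mulr0 add0r.
- rewrite mulrDr !mulrDl aayy ff [f * (y * y)]mulrA fy mul0r addr0.
  by rewrite -[a * a * f]mulrA af mulr0 add0r.
Qed.

Theorem theorem3p12 (R : pzRingType) (star : R -> R)
    (star_inv : ring_involution star)
    (a acore : R) (a_core : is_core_inverse star a acore) :
  [<-> is_EP star a;
       exists u : R, two_sided_unit u /\ acore = u * a;
       exists b : R, acore = b * a].
Proof.
tfae.
- move=> [x [y [mp gp xy]]]; rewrite xy in mp.
  rewrite (core_inverse_of_EP R star a acore y star_inv a_core mp gp).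
  exact: group_inverse_unit_multiple.
- by move=> [u [_ ->]]; exists u.
- move=> [b acoreE].
  have [xax sym _ axx] :=
    core_inverse_equations R star a acore star_inv a_core.
  have [axa _ _] := a_core.
  have xxa : acore = acore * acore * a.
    by rewrite {2}acoreE -!mulrA [a * _]mulrA axa.
  have comm : a * acore = acore * a by rewrite {1}xxa !mulrA axx.
  by exists acore, acore; split=> //; split=> //; rewrite -comm.
Qed.
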